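(* Let $(X,d)$ be a compact quasihypermetric space with $M(X) < \infty$, and suppose that $Y \subseteq X$ is a (compact) maximal strictly quasihypermetric subspace of $X$. Then every sequence $(\mu_n)$ in $\mathcal{M}_1(Y)$ which is a maximal sequence on $Y$ is also, when considered as a sequence in $\mathcal{M}_1(X)$, a maximal sequence on $X$. Also, $M(Y) = M(X)$.
   Context: For a compact metric space $(X,d)$, $\mathcal{M}(X)$ is the space of finite signed Borel measures on $X$; $\mathcal{M}_0(X)$ and $\mathcal{M}_1(X)$ are the subsets of measures of total mass $0$ and $1$, respectively. For $\mu \in \mathcal{M}(X)$ put $I(\mu) = \int_X\int_X d(x,y)\,d\mu(x)\,d\mu(y)$, and let $M(X) = \sup\{I(\mu) : \mu \in \mathcal{M}_1(X)\}$ (possibly $\infty$). $X$ is quasihypermetric if $I(\mu) \le 0$ for all $\mu \in \mathcal{M}_0(X)$, and strictly quasihypermetric if in addition, for $\mu \in \mathcal{M}_0(X)$, $I(\mu) = 0$ only when $\mu = 0$. A non-empty subspace $Y$ of a compact quasihypermetric space $X$ (with the restricted metric) is a maximal strictly quasihypermetric subspace of $X$ if $Y$ is compact and strictly quasihypermetric and no compact strictly quasihypermetric subspace of $X$ properly contains $Y$. For a compact quasihypermetric space $Z$ with $M(Z)<\infty$, a sequence $(\mu_n)$ in $\mathcal{M}_1(Z)$ is a maximal sequence on $Z$ if $I(\mu_n) \to M(Z)$ as $n\to\infty$. Measures on $Y$ are regarded as measures on $X$ via extension by zero. *)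

(* Defs.v *)
From HB Require Import structures.
From mathcomp Require Import all_boot all_order all_algebra.
From mathcomp Require Import all_classical all_reals all_analysis.

Set Implicit Arguments.
Unset Strict Implicit.
Unset Printing Implicit Defensive.

Import Order.TTheory GRing.Theory Num.Theory.
Import numFieldNormedType.Exports.

Local Open Scope classical_set_scope.
Local Open Scope ring_scope.

(* Measurable types are pointed in the library, hence so are the metric spaces
   below; no definition depends on the choice of the point. *)
#[short(type="pmetricType")]
HB.structure Definition PointedMetric (R : numDomainType) :=
  { T of Pointed T & Metric R T }.

Section subspace_metric.
Context {R : realType} {X : metricType R} (A : set X).

Let dist (x y : A) : R := mdist (set_val x) (set_val y).

Let dist_ge0 x y : 0 <= dist x y. Proof. exact: mdist_ge0. Qed.

Let dist_positivity x y : dist x y = 0 -> x = y.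
Proof. by move/mdist_positivity => /val_inj. Qed.

Let ballEdist (x : A) (e : R) : ball x e = [set y | dist x y < e].
Proof.
by rewrite -[LHS]/(set_val @^-1` ball (set_val x) e) ballEmdist.
Qed.

HB.instance Definition _ := @PseudoMetric_isMetric.Build R A
  dist dist_ge0 dist_positivity ballEdist.

End subspace_metric.

Definition msubspace {R : realType} {X : metricType R} (A : set X)
  (A0 : A !=set0) : Type := A.

Section msubspace_instances.
Context {R : realType} {X : metricType R} (A : set X) (A0 : A !=set0).

HB.instance Definition _ := Metric.copy (msubspace A0) A.

HB.instance Definition _ := isPointed.Build (msubspace A0)
  (exist _ (sval (cid A0)) (mem_set (svalP (cid A0))) : A).

End msubspace_instances.

Section charge_integral.
Context d (T : measurableType d) (R : realType).
Variable nu : {charge set T -> \bar R}.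

Let hahnP := cid (Hahn_decomposition nu).
Let hahnN := cid (svalP hahnP).

(* Hahn decompositions are unique up to null sets, so the value does not depend
   on the one chosen. *)
Definition charge_integral (f : T -> R) : R :=
  \int[jordan_pos (svalP hahnN)]_x f x - \int[jordan_neg (svalP hahnN)]_x f x.

End charge_integral.

Notation borel Z := (g_sigma_algebraType (@open Z)).

Section quasihypermetric.
Context {R : realType}.
Implicit Types X Z : pmetricType R.

Definition signed_measure Z := {charge set (borel Z) -> \bar R}.

Definition energy Z (mu : signed_measure Z) : R :=
  charge_integral mu (fun y : Z => charge_integral mu (fun x : Z => mdist x y)).

Definition mass0 Z : set (signed_measure Z) := [set mu | mu [set: Z] = 0%E].

Definition mass1 Z : set (signed_measure Z) := [set mu | mu [set: Z] = 1%E].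

Definition max_energy Z : \bar R :=
  ereal_sup [set (energy mu)%:E | mu in @mass1 Z].

Definition quasihypermetric Z : Prop :=
  forall mu : signed_measure Z, mass0 mu -> energy mu <= 0.

(* A charge is a function on all subsets whose values are only meaningful on
   measurable sets, so that nullity is tested on the latter. *)
Definition strictly_quasihypermetric Z : Prop :=
  quasihypermetric Z /\
  forall mu : signed_measure Z, mass0 mu -> energy mu = 0 ->
    forall A : set (borel Z), measurable A -> mu A = 0%E.

Definition maximal_sequence Z (mu : nat -> signed_measure Z) : Prop :=
  (forall n, mass1 (mu n)) /\
  (energy (mu n))%:E @[n --> \oo] --> max_energy Z.

Definition maximal_strictly_quasihypermetric X (Y : set X) (Y0 : Y !=set0) :
    Prop :=
  [/\ compact Y, strictly_quasihypermetric (msubspace Y0) &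
    forall (Z : set X) (Z0 : Z !=set0), compact Z ->
      strictly_quasihypermetric (msubspace Z0) -> Y `<=` Z -> Z = Y].

Section extension_by_zero.
Context X (Y : set X) (Y0 : Y !=set0).

Let incl : borel (msubspace Y0) -> borel X := @set_val X Y.

Let measurable_incl : measurable_fun [set: borel (msubspace Y0)] incl.
Proof.
refine (@measurability _ _ (borel (msubspace Y0)) (borel X) setT incl
  (@open X) _ _) => //.
move=> _ [U oU <-]; rewrite setTI; apply: sub_sigma_algebra.
exact: (open_comp (fun x _ => @initial_continuous _ _ (@set_val X Y) x) oU).
Qed.

Variable mu : signed_measure (msubspace Y0).

(* A |-> mu (A `&` Y), with A `&` Y seen as a subset of Y *)
Definition extend_by_zero_fun : set (borel X) -> \bar R := pushforward mu incl.

Local Notation ext := extend_by_zero_fun.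

Let measurable_preimage A : measurable A -> measurable (incl @^-1` A).
Proof.
by move=> mA; rewrite -[X in measurable X]setTI; exact: measurable_incl.
Qed.

Let ext0 : ext set0 = 0%E.
Proof. by rewrite /ext /pushforward preimage_set0 charge0. Qed.

Let ext_finite A : measurable A -> ext A \is a fin_num.
Proof.
move=> mA; exact: (@fin_num_measure _ _ _ mu _ (measurable_preimage mA)).
Qed.

Let ext_sigma_additive : semi_sigma_additive ext.
Proof.
move=> F mF tF mUF; rewrite /ext /pushforward preimage_bigcup.
apply: charge_semi_sigma_additive.
- by move=> n; exact: measurable_preimage.
- apply/trivIsetP => /= i j _ _ ij; rewrite -preimage_setI.
  by move/trivIsetP : tF => /(_ _ _ _ _ ij) ->//; rewrite preimage_set0.
- by rewrite -preimage_bigcup; exact: measurable_preimage.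
Qed.

HB.instance Definition _ := isCharge.Build _ _ _ ext
  ext0 ext_finite ext_sigma_additive.

Definition extend_by_zero : signed_measure X := ext.

End extension_by_zero.

End quasihypermetric.

(* Main.v *)
Require Import Defs.
From mathcomp Require Import all_boot all_order all_algebra.
From mathcomp Require Import all_classical all_reals all_analysis.
From mathcomp Require Import lra ring.

(** Let [x] lie outside [Y]. By maximality [Y `|` [set x]] carries a non-zero
    charge [m] of mass 0 and energy 0, and [m [set x] != 0] because [Y] is
    strictly quasihypermetric. As [energy (delta_z + t m) = 2 t potential m z]
    stays below [max_energy X] for every real [t], the potential of [m]
    vanishes; rescaling, some [nu_x] of mass 1 on [Y] has the same potential as
    the Dirac mass at [x]. Replacing each [delta_{x_i}] by [nu_{x_i}] in a
    discretisation [\sum_i m(A_i) delta_{x_i}] of a mass 1 charge [m] on [X]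
    does not change the energy, so the energies of mass 1 charges on [Y]
    approximate [energy m].

    Everything known about [charge_integral] comes from one estimate: if
    [|f - v_i| <= e] on the cells [A_i] of a finite measurable partition, the
    integral is within [e * charge_norm m] of [\sum_i v_i m(A_i)]. It yields
    linearity in the charge, the change of variables, and, in place of Fubini's
    theorem, the symmetry of the mutual energy. *)

Set Implicit Arguments.
Unset Strict Implicit.
Unset Printing Implicit Defensive.

Import Order.TTheory GRing.Theory Num.Theory.
Import numFieldNormedType.Exports.

Local Open Scope classical_set_scope.
Local Open Scope ring_scope.

(** * Integration against charges by finite step functions *)

Section step_approximation.
Context {d : measure_display} {T : measurableType d} {R : realType}.
Implicit Types (A : nat -> set T) (f : T -> R) (v : nat -> R).

Definition measurable_partition n A : Prop :=
  [/\ forall i, measurable (A i), trivIset setT A &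
      \big[setU/set0]_(i < n) A i = setT].

Definition step_approx (e : R) n A v f : Prop :=
  forall i x, (i < n)%N -> A i x -> `|f x - v i| <= e.

Definition step_approximable f : Prop :=
  measurable_fun setT f /\
  forall e, 0 < e -> exists n A v, measurable_partition n A /\ step_approx e n A v f.

Lemma bounded_step_approx e n A v f : measurable_partition n A ->
  step_approx e n A v f -> [bounded f x | x in setT].
Proof.
move=> [_ _ cA] fv; exists (e + \sum_(i < n) `|v i|); split; first exact: num_real.
move=> M eM x _; apply/ltW/(le_lt_trans _ eM).
have : (\big[setU/set0]_(i < n) A i) x by rewrite cA.
rewrite -bigcup_mkord => -[i /= ltin Aix].
rewrite -[f x](subrK (v i)) (le_trans (ler_normD _ _))// lerD ?fv//.
by rewrite (bigD1 (Ordinal ltin))//= lerDl sumr_ge0.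
Qed.

(** Induction on the number of cells: on the cell [A k] the function [f - v k] is at most [e] in
    absolute value, and the errors add up because the cells are disjoint. *)
Lemma Rintegral_step_approx (m : {finite_measure set T -> \bar R}) e n A v f :
  measurable_fun setT f -> measurable_partition n A -> step_approx e n A v f ->
  `|\int[m]_x f x - \sum_(i < n) v i * fine (m (A i))| <= e * fine (m setT).
Proof.
move=> mf PA fv; have bf := bounded_step_approx PA fv.
have [mA tA cA] := PA.
have fin B : measurable B -> (m B < +oo)%E.
  by move=> mB; rewrite ltey_eq fin_num_measure.
have intf B : measurable B -> m.-integrable B (EFin \o f).
  move=> mB; apply: (integrableS measurableT mB) => //.
  by apply: measurable_bounded_integrable => //; exact: fin.
have intc B c : measurable B -> m.-integrable B (EFin \o cst c).
  by move=> mB; apply: finite_measure_integrable_cst.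
suff H k : (k <= n)%N -> `|\int[m]_(x in \big[setU/set0]_(i < k) A i) f x
    - \sum_(i < k) v i * fine (m (A i))|
    <= e * fine (m (\big[setU/set0]_(i < k) A i)).
  by have := H n (leqnn n); rewrite cA.
elim: k => [|k IH] ltkn.
  by rewrite !big_ord0 Rintegral_set0 measure0 mulr0 subrr normr0.
have mU : measurable (\big[setU/set0]_(i < k) A i).
  by apply: bigsetU_measurable.
have dU : (\big[setU/set0]_(i < k) A i) `&` A k = set0.
  rewrite -bigcup_mkord setI_bigcupl bigcup0// => i /= ltik.
  move/trivIsetP : tA => /(_ i k I I); apply.
  by rewrite neq_ltn ltik.
rewrite !big_ord_recr/= Rintegral_setU//; last 2 first.
- by apply: intf; exact: measurableU.
- by apply/disj_setPS; rewrite dU.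
rewrite measureU// fineD ?fin_num_measure// mulrDr opprD addrACA.
rewrite (le_trans (ler_normD _ _))// lerD// ?IH// 1?ltnW//.
rewrite -Rintegral_cst// -RintegralB//; [|exact: intf|exact: intc].
have intfc : m.-integrable (A k) (EFin \o (fun x => f x - v k)).
  apply: (@eq_integrable _ _ _ m _ (mA k) ((EFin \o f) \- (EFin \o cst (v k)))%E) => //.
  by apply: integrableB => //; [exact: intf|exact: intc].
apply: (le_trans (le_normr_Rintegral _ _)) => //.
rewrite -Rintegral_cst//; apply: le_Rintegral => //.
- exact: integrable_norm.
- exact: intc.
- by move=> x Akx; exact: fv.
Qed.

(** This is the total variation of [m]. It is read off the same chosen Hahn decomposition as
    [charge_integral], so both involve the same Jordan parts. *)
Definition charge_norm (m : {charge set T -> \bar R}) : R :=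
  let h := svalP (cid (svalP (cid (Hahn_decomposition m)))) in
  fine (jordan_pos h setT) + fine (jordan_neg h setT).

Lemma charge_norm_ge0 m : 0 <= charge_norm m.
Proof. by rewrite addr_ge0 ?fine_ge0. Qed.

Lemma charge_integral_step_approx (m : {charge set T -> \bar R}) e n A v f :
  measurable_fun setT f -> measurable_partition n A -> step_approx e n A v f ->
  `|charge_integral m f - \sum_(i < n) v i * fine (m (A i))|
    <= e * charge_norm m.
Proof.
move=> mf PA fv.
pose h := svalP (cid (svalP (cid (Hahn_decomposition m)))).
have -> : charge_integral m f =
  \int[jordan_pos h]_x f x - \int[jordan_neg h]_x f x by [].
have -> : charge_norm m =
  fine (jordan_pos h setT) + fine (jordan_neg h setT) by [].
have mE i : fine (m (A i)) = fine (jordan_pos h (A i)) - fine (jordan_neg h (A i)).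
  have [mA _ _] := PA.
  rewrite (jordan_decomp h)//.
  have -> : cadd (jordan_pos h) (cscale (-1) (jordan_neg h)) (A i) =
    (jordan_pos h (A i) + (-1)%:E * jordan_neg h (A i))%E by [].
  by rewrite EFinN mulN1e fineB ?fin_num_measure.
under eq_bigr do rewrite mE mulrBr.
have := Rintegral_step_approx (jordan_pos h) mf PA fv.
have := Rintegral_step_approx (jordan_neg h) mf PA fv.
rewrite sumrB mulrDr => Hn Hp.
rewrite opprD addrACA -opprD (le_trans (ler_normB _ _))//.
exact: lerD.
Qed.

Lemma eq_of_dist_le (a b C : R) : 0 <= C ->
  (forall e, 0 < e -> `|a - b| <= e * C) -> a = b.
Proof.
move=> C0 H; apply/eqP; rewrite -subr_eq0 -normr_le0.
apply/ler_addgt0Pr => e e0; rewrite add0r.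
have C1 : 0 < C + 1 by rewrite ltr_wpDl.
(* [C] may vanish, hence the denominator [C + 1]. *)
apply: (le_trans (H (e / (C + 1)) _)); first by rewrite divr_gt0.
by rewrite mulrAC ler_pdivrMr// ler_pM2l// lerDl.
Qed.

(** The hypothesis is used only on the cells of a partition, where both sides become finite sums.
    The unrelated Hahn decompositions of [m] and of the [mk k] are never compared. *)
Lemma charge_integral_lincomb (m : {charge set T -> \bar R}) N (a : 'I_N -> R)
    (mk : 'I_N -> {charge set T -> \bar R}) f :
  step_approximable f ->
  (forall B, measurable B -> fine (m B) = \sum_k a k * fine (mk k B)) ->
  charge_integral m f = \sum_k a k * charge_integral (mk k) f.
Proof.
move=> [mf af] mE.
apply: (@eq_of_dist_le _ _
    (charge_norm m + \sum_k `|a k| * charge_norm (mk k))) => [|e e0].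
  rewrite addr_ge0 ?charge_norm_ge0// sumr_ge0// => k _.
  by rewrite mulr_ge0// charge_norm_ge0.
have [n [A [v [PA fv]]]] := af e e0; have [mA _ _] := PA.
have -> : charge_integral m f - \sum_k a k * charge_integral (mk k) f =
    (charge_integral m f - \sum_(i < n) v i * fine (m (A i))) -
    \sum_k a k * (charge_integral (mk k) f - \sum_(i < n) v i * fine (mk k (A i))).
  have -> : \sum_(i < n) v i * fine (m (A i)) =
      \sum_k a k * \sum_(i < n) v i * fine (mk k (A i)).
    under [RHS]eq_bigr do rewrite mulr_sumr.
    rewrite exchange_big/=; apply: eq_bigr => i _.
    by rewrite mE// mulr_sumr; apply: eq_bigr => k _; rewrite mulrCA.
  move: (charge_integral m f) => L.
  rewrite -addrA -opprD -big_split/=; congr (_ - _).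
  by apply: eq_bigr => k _; rewrite -mulrDr addrC subrK.
rewrite (le_trans (ler_normB _ _))// mulrDr lerD//.
  exact: charge_integral_step_approx.
rewrite mulr_sumr (le_trans (ler_norm_sum _ _ _))// ler_sum// => k _.
rewrite normrM mulrCA ler_wpM2l//.
exact: charge_integral_step_approx.
Qed.

(** Exactly one cell contains [z], so the approximating sum reduces to the value on that cell, which
    is [e]-close to [f z]. *)
Lemma charge_integral_dirac (m : {charge set T -> \bar R}) z f :
  step_approximable f ->
  (forall B, measurable B -> fine (m B) = \1_B z) ->
  charge_integral m f = f z.
Proof.
move=> [mf af] mE.
apply: (@eq_of_dist_le _ _ (charge_norm m + 1)) => [|e e0].
  by rewrite addr_ge0// charge_norm_ge0.
have [n [A [v [PA fv]]]] := af e e0; have [mA tA cA] := PA.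
have : (\big[setU/set0]_(i < n) A i) z by rewrite cA.
rewrite -bigcup_mkord => -[i /= ltin Aiz].
have Sv : \sum_(i < n) v i * fine (m (A i)) = v i.
  rewrite (bigD1 (Ordinal ltin))//= mE// indicE mem_set// mulr1.
  rewrite big1 ?addr0// => j ji; rewrite mE// indicE memNset ?mulr0// => Ajz.
  move/trivIsetP : tA => /(_ j i I I ji) => /seteqP[+ _].
  by move=> /(_ z); exact.
rewrite mulrDr mulr1 -[charge_integral m f](subrK (v i)) -addrA.
rewrite (le_trans (ler_normD _ _))// lerD//.
  by rewrite -{1}Sv; exact: charge_integral_step_approx.
by rewrite distrC; exact: fv.
Qed.

End step_approximation.

(** The preimages of the cells partition [T] and approximate [f \o phi] with the same values, so
    both integrals are close to one and the same sum. *)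
Lemma charge_integral_pushforward {d d' : measure_display}
    {T : measurableType d} {T' : measurableType d'} {R : realType}
    (m : {charge set T -> \bar R}) (m' : {charge set T' -> \bar R})
    (phi : T -> T') (f : T' -> R) :
  measurable_fun setT phi -> step_approximable f ->
  (forall B, measurable B -> fine (m' B) = fine (m (phi @^-1` B))) ->
  charge_integral m' f = charge_integral m (f \o phi).
Proof.
move=> mphi [mf af] mE.
apply: (@eq_of_dist_le _ _ _ (charge_norm m' + charge_norm m)) => [|e e0].
  by rewrite addr_ge0 ?charge_norm_ge0.
have [n [A [v [PA fv]]]] := af e e0; have [mA tA cA] := PA.
have PA' : measurable_partition n (fun i => phi @^-1` A i).
  split.
  - by move=> i; rewrite -[X in measurable X]setTI; exact: mphi.
  - apply/trivIsetP => i j _ _ ij; rewrite -preimage_setI.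
    by move/trivIsetP : tA => -> //; rewrite preimage_set0.
  - rewrite -(bigcup_mkord n (fun i => phi @^-1` A i)) -preimage_bigcup.
    by rewrite bigcup_mkord cA preimage_setT.
have S : \sum_(i < n) v i * fine (m' (A i)) =
    \sum_(i < n) v i * fine (m (phi @^-1` A i)).
  by apply: eq_bigr => i _; rewrite mE.
rewrite -[charge_integral m' f](subrK (\sum_(i < n) v i * fine (m' (A i)))) -addrA.
rewrite (le_trans (ler_normD _ _))// mulrDr lerD//.
  exact: charge_integral_step_approx.
rewrite S distrC.
apply: (@charge_integral_step_approx _ _ _ m e n (fun i => phi @^-1` A i) v) => //.
  exact: measurableT_comp.
by move=> i x ltin Aix; exact: fv.
Qed.

(** * Potentials and mutual energy on a compact metric space *)

Lemma borel_open_measurable {R : realType} {X : pmetricType R} (U : set X) :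
  open U -> measurable (U : set (borel X)).
Proof. by move=> oU; exact: sub_sigma_algebra. Qed.

Lemma borel_closed_measurable {R : realType} {X : pmetricType R} (F : set X) :
  closed F -> measurable (F : set (borel X)).
Proof.
move=> cF; rewrite -[F]setCK; apply: measurableC.
by apply: borel_open_measurable; exact: closed_openC.
Qed.

Lemma continuous_borel_measurable {R : realType} {X : pmetricType R}
  (f : X -> R) : continuous f -> measurable_fun [set: borel X] f.
Proof.
move=> /continuousP cf; apply: (measurability _ (measurable_realfun.RGenOpens.measurableE R)).
move=> _ [_ [a [b ->] <-]]; rewrite setTI.
by apply: borel_open_measurable; apply: cf; exact: interval_open.
Qed.

Section compact_metric.
Context {R : realType} {X : pmetricType R}.
Hypothesis compactX : compact [set: X].
Implicit Types (m : signed_measure X) (x y z : X).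

Definition mesh_partition (e : R) n (A : nat -> set (borel X)) (p : nat -> X) :=
  measurable_partition n A /\
  forall i x, (i < n)%N -> A i x -> mdist x (p i) <= e.

Lemma ex_mesh_partition e : 0 < e -> exists n A p, mesh_partition e n A p.
Proof.
move=> e0; move: compactX; rewrite compact_cover.
move=> /(_ X setT (fun x => (ball x e)^°)).
case=> [x _|x _|D _ cD].
- exact: open_interior.
- by exists x => //; exact: nbhsx_ballx.
pose s : seq X := finmap.enum_fset D.
(* Past the end of [s] the centre is the default [point]; only the first [size s] cells are used,
   while [seqDU] keeps the whole sequence disjoint. *)
pose p i := nth point s i.
exists (size s), (seqDU (fun i => (ball (p i) e)^°)), p.
split; [split|].
- move=> i; apply: measurableD; first by apply: borel_open_measurable; exact: open_interior.
  apply: bigsetU_measurable => k _.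
  by apply: borel_open_measurable; exact: open_interior.
- exact: trivIset_seqDU.
- rewrite -(@bigsetU_seqDU X) -subTset => x /cD[y /= yD yx].
  rewrite -(bigcup_mkord _ (fun i => (ball (p i) e)^°)).
  exists (index y s); first by rewrite /= index_mem.
  by rewrite /p nth_index.
- move=> i x _ /(@subset_seqDU X _ i)/nbhs_singleton.
  rewrite ballEmdist/= metric_sym.
  exact: ltW.
Qed.

Lemma uniform_step_approximable (f : X -> R) :
  (forall e, 0 < e -> exists2 r, 0 < r &
     forall x y, mdist x y <= r -> `|f x - f y| <= e) ->
  step_approximable (f : borel X -> R).
Proof.
move=> uf; split.
  apply: continuous_borel_measurable => x; apply/cvgrPdist_le => e e0.
  have [r r0 H] := uf e e0.
  apply: filterS (nbhsx_ballx x r r0) => y.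
  by rewrite ballEmdist => /ltW; exact: H.
move=> e e0; have [r r0 H] := uf e e0.
have [n [A [p [PA Ap]]]] := ex_mesh_partition r0.
exists n, A, (f \o p); split => // i x ltin Aix.
by apply: H; exact: Ap.
Qed.

Lemma ler_dist_mdist (x x' y y' : X) :
  `|mdist x y - mdist x' y'| <= mdist x x' + mdist y y'.
Proof.
have := metric_triangle x x' y; have := metric_triangle x' y' y.
have := metric_triangle x' x y'; have := metric_triangle x y y'.
rewrite (metric_sym y' y) (metric_sym x' x) ler_norml.
move=> *; apply/andP; split; lra.
Qed.

Lemma mdist_step_approximable y :
  step_approximable (fun x : borel X => mdist (x : X) y).
Proof.
apply: uniform_step_approximable => e e0; exists e => // x x' xx'.
by rewrite (le_trans (ler_dist_mdist _ _ _ _))// mdistxx addr0.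
Qed.

Definition potential m y : R := charge_integral m (fun x : X => mdist x y).

Lemma potential_mesh m e n A p y y' : mesh_partition e n A p ->
  mdist y y' <= e ->
  `|potential m y - \sum_(i < n) mdist (p i) y' * fine (m (A i))|
    <= 2 * e * charge_norm m.
Proof.
move=> [PA Ap] yy'; apply: (@charge_integral_step_approx _ _ _ m _ n A (fun i => mdist (p i) y')) => //.
  exact: (mdist_step_approximable y).1.
move=> i x ltin Aix; rewrite (le_trans (ler_dist_mdist _ _ _ _))//.
by rewrite mulr_natl mulr2n lerD//; exact: Ap.
Qed.

Lemma potential_step_approximable m :
  step_approximable (potential m : borel X -> R).
Proof.
apply: uniform_step_approximable => e e0.
(* Two uses of [potential_mesh] cost [4 * charge_norm m] times the mesh size; the [+ 1] makes [C]
   positive. *)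
pose C := 4 * (charge_norm m + 1).
have C0 : 0 < C by rewrite mulr_gt0// ltr_wpDl// charge_norm_ge0.
exists (e / C) => [|x y xy]; first by rewrite divr_gt0.
have e1 : 0 < e / C by rewrite divr_gt0.
have [n [A [p PA]]] := ex_mesh_partition e1.
have H1 := potential_mesh m PA xy.
have yy : mdist y y <= e / C by rewrite mdistxx ltW.
have H2 := potential_mesh m PA yy; rewrite distrC in H2.
set S := \sum_(i < n) _ in H1 H2.
have -> : potential m x - potential m y =
  (potential m x - S) + (S - potential m y) by rewrite addrA subrK.
rewrite (le_trans (ler_normD _ _))// (le_trans (lerD H1 H2))//.
have rC : e / C * C = e by rewrite divfK// gt_eqF.
rewrite -[leRHS]rC /C; move: (e / C) e1 => r r0; lra.
Qed.

Definition mutual_energy m1 m2 : R := charge_integral m2 (potential m1).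

Lemma energyE m : energy m = mutual_energy m m. Proof. by []. Qed.

Lemma mutual_energy_mesh m1 m2 e n A p : 0 <= e -> mesh_partition e n A p ->
  `|mutual_energy m1 m2 -
     \sum_(j < n) (\sum_(i < n) mdist (p i) (p j) * fine (m1 (A i)))
       * fine (m2 (A j))|
    <= e * (2 * charge_norm m1 * charge_norm m2).
Proof.
move=> e0 PA; have := PA => -[PA' Ap].
rewrite (_ : e * _ = 2 * e * charge_norm m1 * charge_norm m2); last by ring.
apply: (@charge_integral_step_approx _ _ _ m2 _ n A
  (fun j => \sum_(i < n) mdist (p i) (p j) * fine (m1 (A i)))) => //.
  exact: (potential_step_approximable m1).1.
by move=> j y ltjn Ajy; apply: potential_mesh => //; exact: Ap.
Qed.

(** With one mesh for both variables, the two iterated integrals are close to double sums that agree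
    by exchanging the finite sums and by the symmetry of [mdist]. *)
Lemma mutual_energyC m1 m2 : mutual_energy m1 m2 = mutual_energy m2 m1.
Proof.
apply: (@eq_of_dist_le _ _ _ (2 * charge_norm m1 * charge_norm m2 +
  2 * charge_norm m2 * charge_norm m1)) => [|e e0].
  by rewrite addr_ge0// !mulr_ge0// charge_norm_ge0.
have [n [A [p PA]]] := ex_mesh_partition e0.
have H1 := mutual_energy_mesh m1 m2 (ltW e0) PA.
have H2 := mutual_energy_mesh m2 m1 (ltW e0) PA; rewrite distrC in H2.
set S1 := \sum_(j < n) _ in H1; set S2 := \sum_(j < n) _ in H2.
have S12 : S1 = S2.
  rewrite /S1 /S2; under eq_bigr do rewrite mulr_suml.
  rewrite exchange_big/=; apply: eq_bigr => i _; rewrite mulr_suml.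
  by apply: eq_bigr => j _; rewrite metric_sym mulrAC.
rewrite -S12 in H2.
have -> : mutual_energy m1 m2 - mutual_energy m2 m1 =
  (mutual_energy m1 m2 - S1) + (S1 - mutual_energy m2 m1) by rewrite addrA subrK.
by rewrite (le_trans (ler_normD _ _))// mulrDr lerD.
Qed.

End compact_metric.

(** * Linear combinations of charges *)

Section charge_combinations.
Context {d : measure_display} {T : measurableType d} {R : realType}.
Implicit Types m : {charge set T -> \bar R}.

(** This is the change of variables along the identity. It needs an argument because the two Hahn
    decompositions are chosen separately. *)
Lemma eq_charge_integral m m' f : step_approximable f ->
  (forall B, measurable B -> fine (m B) = fine (m' B)) ->
  charge_integral m f = charge_integral m' f.
Proof. by move=> af; exact: (charge_integral_pushforward (@measurable_id _ _ _)). Qed.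

Lemma fine_cscale t m B : measurable B -> fine (cscale t m B) = t * fine (m B).
Proof. by move=> mB; rewrite /cscale fineM ?fin_num_measure. Qed.

Lemma fine_caddZ m1 m2 t B : measurable B ->
  fine (cadd m1 (cscale t m2) B) = fine (m1 B) + t * fine (m2 B).
Proof. by move=> mB; rewrite /cadd fineD ?fin_num_measure// fine_cscale. Qed.

Lemma charge_integral_caddZ m1 m2 t f : step_approximable f ->
  charge_integral (cadd m1 (cscale t m2)) f =
  charge_integral m1 f + t * charge_integral m2 f.
Proof.
move=> af.
rewrite (@charge_integral_lincomb _ _ _ _ 2 (fun i => if i == 0 then 1 else t)
    (fun i => if i == 0 then m1 else m2))//.
  by rewrite !big_ord_recl big_ord0/= mul1r addr0.
by move=> B mB; rewrite fine_caddZ// !big_ord_recl big_ord0/= mul1r addr0.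
Qed.

Lemma ex_charge_lincomb n (a : nat -> R) (mk : nat -> {charge set T -> \bar R}) :
  exists m, forall B, measurable B -> fine (m B) = \sum_(i < n) a i * fine (mk i B).
Proof.
elim: n => [|n [m mE]].
  by exists (czero : {charge set T -> \bar R}) => B _; rewrite big_ord0.
exists (cadd m (cscale (a n) (mk n))) => B mB.
by rewrite fine_caddZ// big_ord_recr/= mE.
Qed.

End charge_combinations.

(** * Dirac charges, and the potential of a charge of mass and energy zero *)

Definition dirac_charge {R : realType} {X : pmetricType R} (z : X) :
  signed_measure X := charge_of_finite_measure (@dirac _ (borel X) z R).

Lemma fine_dirac_charge {R : realType} {X : pmetricType R} (z : X) B :
  fine (dirac_charge z B) = \1_B z.
Proof. by rewrite -[dirac_charge z B]/(@dirac _ (borel X) z R B) diracE indicE. Qed.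

Lemma massP {R : realType} {X : pmetricType R} (m : signed_measure X) r :
  m [set: X] = r%:E <-> fine (m [set: X]) = r.
Proof.
split=> [->//|<-]; rewrite fineK//.
by apply: (@fin_num_measure _ _ _ m); exact: measurableT.
Qed.

Section null_measures.
Context {R : realType} {X : pmetricType R}.
Hypothesis compactX : compact [set: X].

Lemma potential_dirac (m : signed_measure X) x y :
  (forall B, measurable B -> fine (m B) = \1_B x) -> potential m y = mdist x y.
Proof.
move=> mE; rewrite /potential.
exact: (charge_integral_dirac (mdist_step_approximable compactX y) mE).
Qed.

Lemma eq_energy (m m' : signed_measure X) :
  (forall B, measurable B -> fine (m B) = fine (m' B)) -> energy m = energy m'.
Proof.
move=> mE; rewrite !energyE.
have potE : potential m = potential m'.
  apply/funext => y.
  exact: (eq_charge_integral (mdist_step_approximable compactX y) mE).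
rewrite /mutual_energy potE.
exact: (eq_charge_integral (potential_step_approximable compactX m') mE).
Qed.

(** Expanding by bilinearity, the square terms are [mdist z z] and [t ^ 2] times the energy of [m],
    both zero; symmetry makes the two cross terms equal. *)
Lemma energy_dirac_add (m : signed_measure X) z t : energy m = 0 ->
  energy (cadd (dirac_charge z) (cscale t m)) = t * potential m z *+ 2.
Proof.
move=> m0; set q : signed_measure X := cadd _ _.
have zE : forall B : set (borel X), measurable B -> fine (dirac_charge z B) = \1_B z.
  by move=> B _; exact: fine_dirac_charge.
have qm : mutual_energy q m = potential m z.
  rewrite (mutual_energyC compactX) /mutual_energy.
  rewrite charge_integral_caddZ; last exact: potential_step_approximable.
  rewrite (charge_integral_dirac (potential_step_approximable compactX m) zE).
  by rewrite -[charge_integral m (potential m)]/(energy m) m0 mulr0 addr0.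
have qz : potential q z = t * potential m z.
  rewrite /potential charge_integral_caddZ; last exact: mdist_step_approximable.
  by rewrite -/(potential (dirac_charge z) z) (potential_dirac z zE) mdistxx add0r.
rewrite energyE {2}/q /mutual_energy charge_integral_caddZ; last first.
  exact: potential_step_approximable.
rewrite (charge_integral_dirac (potential_step_approximable compactX q) zE).
by rewrite -/(mutual_energy q m) qm qz mulr2n.
Qed.

Lemma null_potential (m : signed_measure X) z :
  (max_energy X < +oo)%E -> mass0 m -> energy m = 0 -> potential m z = 0.
Proof.
move=> Mfin m0 e0; apply/eqP; apply: contraT => pz.
have ub t : ((t * potential m z *+ 2)%:E <= max_energy X)%E.
  rewrite -energy_dirac_add//; apply: ereal_sup_ubound.
  exists (cadd (dirac_charge z) (cscale t m)) => //.
  apply/massP; rewrite fine_caddZ; last exact: measurableT.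
  by rewrite fine_dirac_charge indicE in_setT m0 mulr0 addr0.
case: (max_energy X) Mfin ub => [M| |] // _ ub; last by have := ub 0.
(* This value of [t] makes the energy equal to one more than the absolute value of [M], hence larger
   than [M]. *)
have := ub ((`|M| + 1) / (potential m z *+ 2)).
rewrite -mulrnAr divfK ?mulrn_eq0// lee_fin.
by rewrite leNgt ltr_pwDr// ler_norm.
Qed.

End null_measures.

(** * Moving charges between a closed subspace and the whole space *)

Section subspace_charges.
Context {R : realType} {X : pmetricType R} {Y : set X} (Y0 : Y !=set0).

Definition subspace_incl : borel (msubspace Y0) -> borel X := @set_val X Y.

Lemma measurable_incl : measurable_fun setT subspace_incl.
Proof.
refine (@measurability _ _ (borel (msubspace Y0)) (borel X) setT subspace_incl
  (@open X) _ _) => //.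
move=> _ [U oU <-]; rewrite setTI; apply: sub_sigma_algebra.
exact: (open_comp (fun x _ => @initial_continuous _ _ (@set_val X Y) x) oU).
Qed.

(** A left inverse of the inclusion, along which charges on [X] are pushed to [Y]. Points off [Y] go
    to the default point, which is harmless once the charge has been restricted to [Y]. *)
Definition subspace_retract (x : borel X) : borel (msubspace Y0) :=
  if pselect (Y x) is left Yx then exist _ x (mem_set Yx) else point.

Lemma subspace_incl_retract x : Y x -> subspace_incl (subspace_retract x) = x.
Proof. by rewrite /subspace_retract; case: pselect. Qed.

Lemma subspace_inclP y : Y (subspace_incl y).
Proof. by apply: set_mem; exact: (valP y). Qed.

Lemma subspace_inclK : cancel subspace_incl subspace_retract.
Proof. by move=> y; apply: val_inj; apply: subspace_incl_retract; exact: subspace_inclP. Qed.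

Hypothesis closedY : closed Y.

Lemma measurable_retract : measurable_fun setT subspace_retract.
Proof.
refine (@measurability _ _ (borel X) (borel (msubspace Y0)) setT subspace_retract
  (@open (msubspace Y0)) _ _) => //.
move=> _ [_ [V oV <-] <-]; rewrite setTI.
have mY := borel_closed_measurable closedY.
(* The complement of [Y] lies in the preimage exactly when the default point lies in [V]. *)
have -> : subspace_retract @^-1` (subspace_incl @^-1` V) =
    (V `&` Y) `|` (~` Y `&` [set _ | V (subspace_incl point)]).
  apply/seteqP; split => x /=.
    rewrite /subspace_retract; case: pselect => Yx Vx; first by left.
    by right.
  case=> [[Vx Yx]|[nYx Vp]]; first by rewrite subspace_incl_retract.
  by rewrite /subspace_retract; case: pselect.
apply: measurableU; first by apply: measurableI => //; exact: borel_open_measurable.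
apply: measurableI; first exact: measurableC.
have [Vp|nVp] := pselect (V (subspace_incl point)).
  by rewrite (_ : [set _ | _] = setT)// -subTset.
by rewrite (_ : [set _ | _] = set0)// -subset0.
Qed.

(* The charge structure of a pushforward needs the measurability of the map,
   which canonical inference cannot find, hence the explicit instance. *)
Definition trace_charge (m : signed_measure X) : signed_measure (msubspace Y0) :=
  measure_function_pushforward__canonical__charge_Charge
    (crestr0 m (borel_closed_measurable closedY)) measurable_retract.

Lemma extend_trace_charge m B : measurable B ->
  extend_by_zero (trace_charge m) B = m (B `&` Y).
Proof.
move=> mB.
(* [crestr0] is zero by convention off the measurable sets, so its argument must be known to be
   measurable. *)
have mB' : measurable (subspace_retract @^-1` (subspace_incl @^-1` B)).
  rewrite -[X in measurable X]setTI; apply: measurable_retract => //.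
  by rewrite -[X in measurable X]setTI; exact: measurable_incl.
rewrite -[LHS]/(crestr0 m (borel_closed_measurable closedY)
  (subspace_retract @^-1` (subspace_incl @^-1` B))).
rewrite /crestr0 mem_set// /crestr; congr (m _).
by apply/seteqP; split => x /= [+ Yx]; rewrite subspace_incl_retract.
Qed.

Lemma extend_by_zero_retract (mu : signed_measure (msubspace Y0)) B :
  extend_by_zero mu (subspace_retract @^-1` B) = mu B.
Proof.
rewrite -[LHS]/(mu (subspace_incl @^-1` (subspace_retract @^-1` B))); congr (mu _).
by apply/seteqP; split => y /=; rewrite subspace_inclK.
Qed.

End subspace_charges.
Arguments subspace_incl {R X Y} Y0 _.
Arguments subspace_retract {R X Y} Y0 _.
Arguments trace_charge {R X Y} Y0 closedY m.

(** Change of variables along the inclusion, in the outer and then in the inner integral; the metric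
    of the subspace is by definition the one of [X] composed with the inclusion. *)
Lemma energy_extend_by_zero {R : realType} {X : pmetricType R} (Y : set X)
    (Y0 : Y !=set0) (mu : signed_measure (msubspace Y0)) :
  compact [set: X] -> energy (extend_by_zero mu) = energy mu.
Proof.
move=> cX; rewrite /energy.
rewrite (charge_integral_pushforward (m := mu) (@measurable_incl _ _ _ Y0)
  (potential_step_approximable cX (extend_by_zero mu)))//.
congr charge_integral; apply/funext => y /=.
exact: (charge_integral_pushforward (m := mu) (m' := extend_by_zero mu)
  (@measurable_incl _ _ _ Y0) (mdist_step_approximable cX (subspace_incl Y0 y))).
Qed.

Lemma quasihypermetric_subspace {R : realType} {X : pmetricType R} (Y : set X)
    (Y0 : Y !=set0) : compact [set: X] ->
  quasihypermetric X -> quasihypermetric (msubspace Y0).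
Proof.
move=> cX qX mu mu0; rewrite -energy_extend_by_zero//; apply: qX.
by rewrite /mass0/= -[RHS]mu0.
Qed.

(** * Representing the points of the space by charges on a maximal subspace *)

Section maximal_subspace.
Context {R : realType} {X : pmetricType R} (Y : set X) (Y0 : Y !=set0).
Hypotheses (compactX : compact [set: X]) (qhX : quasihypermetric X).
Hypothesis max_fin : (max_energy X < +oo)%E.
Hypothesis maxY : maximal_strictly_quasihypermetric Y0.

Let compactY : compact Y. Proof. by have [] := maxY. Qed.

Let closedY : closed Y.
Proof. by apply: compact_closed => //; exact: metric_hausdorff. Qed.

(** The charge witnesses that strictness fails once [x] is added to [Y], so it is carried by [Y] and
    [x]. Without mass at [x] it would be the extension of its trace on [Y], which strictness of [Y]
    forces to vanish. *)
Lemma ex_null_charge x : ~ Y x -> exists m : signed_measure X,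
  [/\ mass0 m, energy m = 0,
      forall B, measurable B -> fine (m B) = fine (m (B `&` Y)) + fine (m [set x]) * \1_B x
    & fine (m [set x]) != 0].
Proof.
move=> nYx; pose Z := Y `|` [set x].
have Z0 : Z !=set0 by exists x; right.
have cZ : compact Z by apply: compactU => //; exact: compact_set1.
have clZ : closed Z by apply: compact_closed => //; exact: metric_hausdorff.
have mx : measurable ([set x] : set (borel X)).
  apply: borel_closed_measurable; apply: compact_closed.
    exact: metric_hausdorff.
  exact: compact_set1.
have mY := borel_closed_measurable closedY.
have : ~ strictly_quasihypermetric (msubspace Z0).
  move=> sZ; have [_ _ /(_ Z Z0 cZ sZ)] := maxY.
  move=> H; apply: nYx; rewrite -H; first by right.
  by move=> y; left.
move=> /not_andP[/(_ (quasihypermetric_subspace compactX qhX))//|].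
move=> /existsNP[mu /not_implyP[mu0 /not_implyP[emu]]].
move=> /existsNP[A /not_implyP[mA muA]].
pose m := extend_by_zero mu.
have m0 : mass0 m by rewrite /mass0/= -[RHS]mu0.
have em : energy m = 0 by rewrite energy_extend_by_zero.
have mE B : measurable B ->
    fine (m B) = fine (m (B `&` Y)) + fine (m [set x]) * \1_B x.
  move=> mB.
  have -> : m B = (m (B `&` Y) + m (B `&` [set x]))%E.
    rewrite -chargeU; last 3 first.
    - exact: measurableI.
    - exact: measurableI.
    - by apply/seteqP; split => // y [[_ Yy] [_ /= yx]]; apply: nYx; rewrite -yx.
    rewrite -setIUr -[LHS]/(mu (subspace_incl Z0 @^-1` B)) -[RHS]/(mu (subspace_incl Z0 @^-1` _)).
    congr (mu _); apply/seteqP; split => y //=; last by case.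
    by move=> By; split => //; exact: (subspace_inclP y).
  rewrite fineD ?fin_num_measure//; [|exact: measurableI|exact: measurableI].
  congr (_ + _); rewrite indicE; have [Bx|nBx] := boolP (x \in B).
    rewrite mulr1 (_ : B `&` [set x] = [set x])//.
    by apply/seteqP; split => [y []//|y /= ->]; split => //; exact: set_mem.
  rewrite mulr0 (_ : B `&` [set x] = set0) ?charge0//.
  by apply/seteqP; split => // y [By /= yx]; move: nBx; rewrite -yx mem_set.
exists m; split => //; apply/negP => /eqP mx0.
(* The set [A] of the subspace is traded for a Borel set of [X], since [m] is compared with the
   extension of its trace on such sets. *)
apply: muA; rewrite -(extend_by_zero_retract mu A).
have mrA : measurable (subspace_retract Z0 @^-1` A).
  by rewrite -[X in measurable X]setTI; exact: (measurable_retract clZ).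
pose nu := trace_charge Y0 closedY m.
have nuE B : measurable B -> extend_by_zero nu B = m B.
  move=> mB; rewrite extend_trace_charge//.
  have := mE B mB; rewrite mx0 mul0r addr0 => /esym H.
  by rewrite -[LHS]fineK ?H ?fineK ?fin_num_measure//; exact: measurableI.
have nu0 : mass0 nu.
  by rewrite /mass0/= -[RHS]m0 -nuE; last exact: measurableT.
have enu : energy nu = 0.
  rewrite -energy_extend_by_zero// -em.
  by apply: eq_energy => // B mB; rewrite nuE.
have [_ sY _] := maxY.
rewrite -(nuE _ mrA); apply: (sY.2 nu nu0 enu).
by rewrite -[X in measurable X]setTI; exact: measurable_incl.
Qed.

Lemma ex_representing_charge x : exists nu : signed_measure (msubspace Y0),
  mass1 nu /\ forall z, potential (extend_by_zero nu) z = mdist x z.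
Proof.
have [Yx|nYx] := pselect (Y x).
  exists (dirac_charge (exist _ x (mem_set Yx) : msubspace Y0)); split.
    by apply/massP; rewrite fine_dirac_charge indicE in_setT.
  by move=> z; exact: potential_dirac.
have [m [m0 em mE c0]] := ex_null_charge nYx.
set c := fine (m [set x]) in mE c0.
(* Subtracting [c^-1] times [m] from the Dirac charge at [x] cancels the mass at [x]; what remains
   lives on [Y] and is [nu]. *)
pose nu : signed_measure (msubspace Y0) := cscale (- c^-1) (trace_charge Y0 closedY m).
have nuE B : measurable B -> fine (extend_by_zero nu B) =
    fine (cadd (dirac_charge x) (cscale (- c^-1) m) B).
  move=> mB; rewrite fine_caddZ// fine_dirac_charge mE//.
  have -> : extend_by_zero nu B =
    cscale (- c^-1) (extend_by_zero (trace_charge Y0 closedY m)) B by [].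
  rewrite fine_cscale// extend_trace_charge// mulrDr.
  by rewrite [_ * (c * _)]mulrA [_ * c]mulNr mulVf// mulN1r addrCA subrr addr0.
exists nu; split.
  apply/massP; have := nuE setT measurableT.
  rewrite fine_caddZ// fine_dirac_charge indicE in_setT.
  by rewrite (_ : fine (m setT) = 0) ?mulr0 ?addr0// m0.
move=> z; rewrite /potential (eq_charge_integral (mdist_step_approximable compactX z) nuE).
rewrite charge_integral_caddZ; last exact: mdist_step_approximable.
rewrite -/(potential m z) (null_potential compactX z max_fin m0 em) mulr0 addr0.
by apply: potential_dirac => // B _; exact: fine_dirac_charge.
Qed.

Lemma energy_le_max_subspace (m : signed_measure X) : mass1 m ->
  ((energy m)%:E <= max_energy (msubspace Y0))%E.
Proof.
move=> m1; have [nu nuP] := choice ex_representing_charge.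
pose C := 2 * charge_norm m * charge_norm m.
have C0 : 0 <= C by rewrite !mulr_ge0// charge_norm_ge0.
have key e : 0 < e -> ((energy m - e * C)%:E <= max_energy (msubspace Y0))%E.
  move=> e0; have [n [A [p PA]]] := ex_mesh_partition compactX e0.
  have [[mA tA cA] _] := PA.
  (* In the discretised [m], each Dirac charge at a centre [p i] is replaced by its representing
     charge on [Y]. *)
  have [mu muE] := ex_charge_lincomb n (fun i => fine (m (A i))) (nu \o p).
  have mu1 : mass1 mu.
    apply/massP; rewrite muE; last exact: measurableT.
    under eq_bigr do rewrite (proj1 (nuP _)) mulr1.
    rewrite sum_fine; last by move=> i _; exact: fin_num_measure.
    rewrite -charge_semi_additive// cA; [exact: (congr1 fine m1)|exact: measurableT].
  pose M := extend_by_zero mu; pose N i := extend_by_zero (nu (p i)).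
  have ME f : step_approximable (f : borel X -> R) -> charge_integral M f =
      \sum_(i < n) fine (m (A i)) * charge_integral (N i) f.
    move=> af; apply: charge_integral_lincomb => // B mB.
    apply: muE; rewrite -[X in measurable X]setTI; exact: measurable_incl.
  have potM y : potential M y = \sum_(i < n) mdist (p i) y * fine (m (A i)).
    rewrite /potential ME; last exact: mdist_step_approximable.
    by apply: eq_bigr => i _; rewrite mulrC -/(potential (N i) y) (proj2 (nuP _)).
  (* By symmetry this is the integral against [M] of the potential of [N j], which is the distance
     to [p j]. Hence [energy mu] is exactly the double sum that approximates [energy m]. *)
  have NM j : charge_integral (N j) (potential M) = potential M (p j).
    rewrite -/(mutual_energy M (N j)) (mutual_energyC compactX) /mutual_energy.
    congr charge_integral; apply/funext => y.
    by rewrite (proj2 (nuP _)) metric_sym.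
  have emu : energy mu = \sum_(j < n)
      (\sum_(i < n) mdist (p i) (p j) * fine (m (A i))) * fine (m (A j)).
    rewrite -(energy_extend_by_zero mu compactX) energyE /mutual_energy -/M ME; last first.
      exact: potential_step_approximable.
    by apply: eq_bigr => j _; rewrite NM potM mulrC.
  have := mutual_energy_mesh compactX m m (ltW e0) PA.
  rewrite -emu -energyE ler_norml => /andP[_ H].
  apply: (@le_trans _ _ (energy mu)%:E); first by rewrite lee_fin lerBlDr addrC -lerBlDr.
  by apply: ereal_sup_ubound; exists mu.
case: (max_energy (msubspace Y0)) key => [M| |] key; last 2 first.
- by rewrite leey.
- by have := key 1 ltr01.
rewrite lee_fin; apply/ler_addgt0Pr => e e0.
have C1 : 0 < C + 1 by rewrite ltr_wpDl.
have := key (e / (C + 1)); rewrite divr_gt0// => /(_ isT).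
rewrite lee_fin lerBlDr => /le_trans; apply; rewrite lerD2l.
by rewrite mulrAC ler_pdivrMr// ler_pM2l// lerDl.
Qed.

Lemma max_energy_subspace : max_energy (msubspace Y0) = max_energy X.
Proof.
apply/eqP; rewrite eq_le; apply/andP; split; apply: ub_ereal_sup => _ [mu mu1 <-].
  rewrite -(energy_extend_by_zero mu compactX); apply: ereal_sup_ubound.
  by exists (extend_by_zero mu) => //; rewrite /mass1/= -[RHS]mu1.
exact: energy_le_max_subspace.
Qed.

End maximal_subspace.

Unset Implicit Arguments.

Theorem theorem2p7 (R : realType) (X : pmetricType R) (Y : set X)
    (Y0 : Y !=set0) :
  compact [set: X] ->
  quasihypermetric X ->
  (max_energy X < +oo)%E ->
  maximal_strictly_quasihypermetric Y0 ->
  (forall mu : nat -> signed_measure (msubspace Y0),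
     maximal_sequence mu ->
     maximal_sequence (fun n => extend_by_zero (mu n))) /\
  max_energy (msubspace Y0) = max_energy X.
Proof.
move=> cX qX MX maxY; have M := max_energy_subspace cX qX MX maxY.
split=> // mu [mu1 cmu]; split; first by move=> n; rewrite /mass1/= -[RHS](mu1 n).
(* Extension by zero preserves every energy, and the suprema agree by [M], so both convergence
   statements coincide. *)
rewrite -M; under eq_fun do rewrite (energy_extend_by_zero _ cX).
exact: cmu.
Qed.
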